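(* Let $G$ be a finite group and let $\mathcal{X}$ be a set of nontrivial irreducible complex characters of $G$. For $\chi\in\mathcal{X}$ let $\rho_\chi$ be the corresponding representation, and let $\mathcal{R} = \{\rho_\chi : \chi \in \mathcal{X}\}$. Assume that $\mathcal{X}$ marks every proper subgroup of $G$. Let $\Sigma \subseteq G$ be a symmetric subset. Then the following are equivalent: 1. The subset $\Sigma$ generates $G$. 2. The graph $\mathrm{Cay}(G,\Sigma)$ admits a spectral gap. 3. For every $\rho \in \mathcal{R}$, the maximal eigenvalue of $A_\rho(\Sigma)$ is strictly less than $|\Sigma|$.
   Context: A subset $\Sigma\subseteq G$ is symmetric if $x\in\Sigma$ implies $x^{-1}\in\Sigma$. For a representation $\rho$ of $G$, $A_\rho(\Sigma) = \sum_{s\in\Sigma}\rho(s)$ (its eigenvalues are real because $\Sigma$ is symmetric). $\mathrm{Cay}(G,\Sigma)$ is the $|\Sigma|$-regular graph with vertex set $G$ and edges $(g,gs)$ for $g\in G$, $s\in\Sigma$ (with a single edge between $g$ and $gs$ if $s^2=1$). A graph admits a spectral gap if the largest eigenvalue $\lambda_1$ of its adjacency matrix has multiplicity $1$ (i.e. $\lambda_1 > \lambda_2$, eigenvalues listed in non-increasing order with multiplicity). A set $\mathcal{X}$ of characters of $G$ marks a subgroup $K\le G$ if there is $\chi\in\mathcal{X}$ such that $\chi|_K$ contains the trivial character $\mathbb{1}_K$ as a summand, i.e. $\langle\chi|_K,\mathbb{1}_K\rangle_K>0$. *)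

(* Defs.v *)
From HB Require Import structures.
From mathcomp Require Import all_boot all_order all_fingroup all_algebra.
From mathcomp Require Import all_solvable all_field all_character.

Set Implicit Arguments.
Unset Strict Implicit.
Unset Printing Implicit Defensive.

Import Order.TTheory GRing.Theory Num.Theory GroupScope.
Local Open Scope ring_scope.

Definition symmetric_set (gT : finGroupType) (Sigma : {set gT}) : Prop :=
  forall x, x \in Sigma -> (x^-1)%g \in Sigma.

(* A set of irreducible characters of G is given by the set of their indices
   in [irr G]; index 0 is the trivial character. *)
Definition marks (gT : finGroupType) (G : {group gT}) (X : {set Iirr G})
    (K : {group gT}) : Prop :=
  exists2 i : Iirr G, i \in X & 0 < '['Res[K] 'chi_i, 1]_K.

(* On [algC], [a <= b] means that [b - a] is a nonnegative real, so a largest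
   eigenvalue must be comparable to all the others; it always exists when
   n > 0 and all the eigenvalues are real. *)
Definition is_max_eigenvalue (n : nat) (A : 'M[algC]_n) (l : algC) : Prop :=
  eigenvalue A l /\ forall m, eigenvalue A m -> m <= l.

(* The finite (di)graph with vertex set V and edge relation e. *)
Definition adjacency_mx (T : finType) (V : {set T}) (e : rel T) : 'M[algC]_#|V| :=
  \matrix_(i, j) (e (enum_val i) (enum_val j))%:R.

(* The multiplicity is the algebraic one, which for the (symmetric) adjacency
   matrix of an undirected graph is also the geometric one. *)
Definition has_spectral_gap (T : finType) (V : {set T}) (e : rel T) : Prop :=
  exists2 l, is_max_eigenvalue (adjacency_mx V e) l
           & mup l (char_poly (adjacency_mx V e)) = 1%N.

(* Edge relation of Cay(G, Sigma); at most one edge joins g to h, and 1 \in Sigma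
   gives a loop, contributing 1 to the diagonal of the adjacency matrix. *)
Definition cayley (gT : finGroupType) (Sigma : {set gT}) : rel gT :=
  fun g h => [exists s in Sigma, h == (g * s)%g].

Definition repr_sum (gT : finGroupType) (G : {group gT}) (n : nat)
    (rG : mx_representation algC G n) (Sigma : {set gT}) : 'M[algC]_n :=
  \sum_(s in Sigma) rG s.

(* Main.v *)
Require Import Defs.
From HB Require Import structures.
From mathcomp Require Import all_boot all_order all_fingroup all_algebra.
From mathcomp Require Import all_solvable all_field all_character.
From mathcomp Require Import ring.

Set Implicit Arguments.
Unset Strict Implicit.
Unset Printing Implicit Defensive.

Import Order.TTheory GRing.Theory Num.Theory GroupScope.
Local Open Scope ring_scope.

(* For a function f on G, sending f to (g |-> sum_(s in Sigma) f (g s)) is the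
   adjacency operator of the Cayley graph.  If f is an eigenfunction for m, the
   Dirichlet form sum_g sum_s |f (g s) - f g|^2 equals
   2 (|Sigma| - m) sum_g |f g|^2: hence m <= |Sigma|, and for m = |Sigma| the
   function f is invariant under right translation by <<Sigma>>.  So the
   eigenspace of |Sigma| is one-dimensional iff Sigma generates G.  An
   eigenvector v of the sum of rho over Sigma has matrix coefficients
   g |-> (v rho(g^-1))_j that are eigenfunctions for the same eigenvalue; thus
   |Sigma| is an eigenvalue of that sum iff rho has nonzero <<Sigma>>-invariants.
   These vanish for a nontrivial irreducible rho if <<Sigma>> = G, while if
   <<Sigma>> is proper the marking hypothesis provides a rho in X having some. *)

(** * Algebraic and geometric multiplicities of eigenvalues *)

Lemma rank_diag_mx (F : fieldType) n (d : 'rV[F]_n) :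
  \rank (diag_mx d) = (\sum_i (d 0 i != 0)%R)%N.
Proof.
elim: n d => [|n IHn] d; first by rewrite big_ord0 flatmx0 mxrank0.
rewrite -[n.+1]/(1 + n)%N in d *.
rewrite -[d]hsubmxK diag_mx_row rank_diag_block_mx IHn.
rewrite big_split_ord /= big_ord1; congr (_ + _)%N.
  rewrite row_mxEl rank_rV; congr (nat_of_bool (~~ _)).
  apply/eqP/eqP=> [/matrixP/(_ 0 0)|d0]; first by rewrite !mxE eqxx.
  by apply/matrixP=> i j; move: d0; rewrite !ord1 !mxE eqxx.
by apply: eq_bigr => i _; rewrite row_mxEr.
Qed.

Lemma char_poly_conj (F : fieldType) n (P D : 'M[F]_n) : P \in unitmx ->
  char_poly (invmx P *m D *m P) = char_poly D.
Proof.
move=> Punit; have P'P: map_mx polyC (invmx P) *m map_mx polyC P = 1%:M.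
  by rewrite -map_mxM mulVmx // map_mx1.
rewrite /char_poly.
have ->: char_poly_mx (invmx P *m D *m P) =
    map_mx polyC (invmx P) *m char_poly_mx D *m map_mx polyC P.
  rewrite /char_poly_mx !map_mxM mulmxBr mulmxBl; congr (_ - _).
  by rewrite mul_mx_scalar -scalemxAl P'P scalemx1.
by rewrite !det_mulmx mulrAC -det_mulmx P'P det1 mul1r.
Qed.

(** By the spectral theorem [A] is similar to a diagonal matrix, and both sides count the diagonal
    entries equal to [a]. This turns the spectral gap into a statement about an eigenspace. *)
Lemma mup_char_poly_normal (C : numClosedFieldType) n (A : 'M[C]_n) (a : C) :
  A \is normalmx -> mup a (char_poly A) = \rank (eigenspace A a).
Proof.
move=> /orthomx_spectralP; have := spectral_unit A.
move: (spectralmx A) (spectral_diag A) => P d Punit ->.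
rewrite char_poly_conj // char_poly_trig ?diag_mx_is_trig //.
have ->: \rank (eigenspace (invmx P *m diag_mx d *m P) a)
         = \rank (kermx (diag_mx (d - const_mx a))).
  rewrite /eigenspace !mxrank_ker; congr (_ - _)%N.
  have ->: invmx P *m diag_mx d *m P - a%:M =
           invmx P *m diag_mx (d - const_mx a) *m P.
    rewrite linearB /= diag_const_mx mulmxBr mulmxBl mul_mx_scalar -scalemxAl.
    by rewrite mulVmx // scalemx1.
  rewrite mxrankMfree ?row_free_unit //.
  by rewrite -mxrank_tr trmx_mul mxrankMfree ?mxrank_tr // row_free_unit
    unitmx_tr unitmx_inv.
rewrite mxrank_ker rank_diag_mx.
rewrite (_ : mup _ _ = \sum_i (d 0 i == a)%R)%N; last first.
  rewrite (eq_bigr (fun i => 'X - (d 0 i)%:P)); last first.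
    by move=> i _; rewrite mxE eqxx.
  (* The multiplicity is additive on nonzero polynomials, so the induction over the product also
     carries nonvanishing. *)
  pose K (p : {poly C}) (m : nat) := p != 0 /\ mup a p = m.
  suff [] : K (\prod_i ('X - (d 0 i)%:P)) (\sum_i (d 0 i == a)%R)%N by [].
  apply: big_ind2 => [|p m q k [p0 <-] [q0 <-]|i _].
  - by split; [exact: oner_neq0 | apply: mupNroot; rewrite root1].
  - by split; [rewrite mulf_neq0 | rewrite mupM].
  - split; first by rewrite polyXsubC_eq0.
    by rewrite -['X - _]expr1 mup_XsubCX; case: ifP.
(* Adding the number of entries different from [a] removes the truncated subtraction: the two counts
   sum to [n]. *)
apply/eqP; rewrite -(eqn_add2r (\sum_i ((d - const_mx a) 0 i != 0)%R)%N) subnK.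
  rewrite -big_split /= (eq_bigr (fun=> 1%N)) => [|i _].
    by rewrite sum1_card card_ord.
  by rewrite !mxE subr_eq0; case: eqP.
by rewrite -[X in (_ <= X)%N]card_ord -sum1_card leq_sum // => i _; case: eqP.
Qed.

(** * Existence of a largest eigenvalue when the spectrum is real *)

Lemma real_seq_max (R : numDomainType) (s : seq R) :
    s != [::] -> {in s, forall x, x \is Num.real} ->
  exists2 l, l \in s & {in s, forall x, x <= l}.
Proof.
elim: s => // x [|y s] IHs _ sR.
  by exists x; rewrite ?mem_head // => z; rewrite inE => /eqP->.
have [||l ls l_max] := IHs; rewrite //.
  by move=> z sz; apply: sR; rewrite inE sz orbT.
have xR: x \is Num.real by apply: sR; rewrite mem_head.
have lR: l \is Num.real by apply: sR; rewrite inE ls orbT.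
case: (real_leP xR lR) => [xl|/ltW lx].
  by exists l => [|z]; rewrite inE ?ls ?orbT // => /predU1P[->|/l_max].
exists x => [|z]; rewrite inE ?eqxx // => /predU1P[->//|/l_max/le_trans->//].
Qed.

Lemma max_eigenvalue_exists n (A : 'M[algC]_n) :
    (0 < n)%N -> (forall m, eigenvalue A m -> m \is Num.real) ->
  exists l, is_max_eigenvalue A l.
Proof.
move=> n_gt0 AR; have [rs def_p] := closed_field_poly_normal (char_poly A).
have rsP m: (m \in rs) = eigenvalue A m.
  rewrite eigenvalue_root_char def_p (monicP (char_poly_monic A)) scale1r.
  by rewrite root_prod_XsubC.
have [a Aa] := eigenvalue_closed A n_gt0.
have [||l ls l_max] := @real_seq_max _ rs.
- by apply: contraTneq Aa => rs0; rewrite -rsP rs0.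
- by move=> m; rewrite rsP; apply: AR.
by exists l; split=> [|m]; rewrite -rsP //; apply: l_max.
Qed.

(** * Eigenfunctions on the Cayley graph *)

Section CayleyEigenfunctions.

Variables (gT : finGroupType) (G : {group gT}) (Sigma : {set gT}).
Hypotheses (Sigma_sub : Sigma \subset G) (Sigma_sym : symmetric_set Sigma).

Implicit Types (f : gT -> algC) (m : algC).

Local Notation A := (adjacency_mx G (cayley Sigma)).

(** Functions live on all of [gT] and are constrained only on [G], so translating them involves no
    conversion to the matrix indices. *)
Definition cayley_eigenfunction f m :=
  {in G, forall g, \sum_(s in Sigma) f (g * s)%g = m * f g}.

Lemma memV_Sigma x : (x^-1%g \in Sigma) = (x \in Sigma).
Proof. by apply/idP/idP=> /Sigma_sym; rewrite ?invgK. Qed.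

Lemma cayleyE g h : cayley Sigma g h = (g^-1 * h \in Sigma)%g.
Proof.
apply/existsP/idP=> [[s /andP[Ss /eqP->]]|Sgh]; first by rewrite mulKg.
by exists (g^-1 * h)%g; rewrite Sgh mulKVg eqxx.
Qed.

Lemma cayley_sym g h : cayley Sigma g h = cayley Sigma h g.
Proof. by rewrite !cayleyE -memV_Sigma invMg invgK. Qed.

Lemma adjacency_cayley_normal : A \is normalmx.
Proof.
apply: symmetric_normalmx.
  apply/is_hermitianmxP; rewrite expr0 scale1r map_mx_id //.
  by apply/matrixP=> i j; rewrite !mxE cayley_sym.
by apply/mxOverP=> i j; rewrite mxE realn.
Qed.

(** A row vector times [A] sums over the in-neighbours of a vertex; by symmetry of [Sigma] these are
    also its out-neighbours. *)
Lemma mul_adjacency_cayley f :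
  \row_i f (enum_val i) *m A
  = \row_j \sum_(s in Sigma) f (enum_val j * s)%g.
Proof.
apply/rowP=> j; rewrite !mxE; set x := enum_val j.
have Gx: x \in G by apply: enum_valP.
under eq_bigr do rewrite !mxE.
rewrite -(big_enum_val (fun g => f g * (cayley Sigma g x)%:R)) /=.
rewrite [RHS](reindex_inj (mulgI x^-1%g)) /=.
rewrite (bigID (fun g => x^-1 * g \in Sigma)%g) /= [X in _ + X]big1 ?addr0.
  apply: eq_big => [g|g /andP[_ Sg]].
    rewrite andb_idl // => /(subsetP Sigma_sub).
    by rewrite groupMl ?groupV.
  by rewrite cayley_sym cayleyE Sg mulr1 mulKVg.
by move=> g /andP[_ /negPf Sg]; rewrite cayley_sym cayleyE Sg mulr0.
Qed.

Lemma cayley_eigenfunctionP f m :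
  cayley_eigenfunction f m <->
  \row_i f (enum_val i) *m A = m *: \row_i f (enum_val i).
Proof.
rewrite mul_adjacency_cayley; split=> [fm | /rowP fm g Gg].
  by apply/rowP=> i; rewrite !mxE fm ?enum_valP.
by have := fm (enum_rank_in Gg g); rewrite !mxE enum_rankK_in.
Qed.

Lemma row_enum_val (v : 'rV[algC]_#|G|) :
  exists f, v = \row_i f (enum_val i).
Proof.
exists (fun g => v 0 (enum_rank_in (group1 G) g)).
by apply/rowP=> i; rewrite !mxE enum_valK_in.
Qed.

(** Reversing every edge permutes the oriented edges, because [Sigma] is closed under inversion. *)
Lemma reindex_edges (F : gT -> gT -> algC) :
  \sum_(g in G) \sum_(s in Sigma) F g (g * s)%g
  = \sum_(g in G) \sum_(s in Sigma) F (g * s)%g g.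
Proof.
rewrite exchange_big [RHS]exchange_big /= (reindex_inj invg_inj) /=.
apply: eq_big => [s|s]; rewrite memV_Sigma // => Ss.
have Gs := subsetP Sigma_sub s Ss.
rewrite (reindex_inj (mulIg s)) /=.
by apply: eq_big => g; rewrite ?groupMr // mulgK.
Qed.

(** With [N] the squared norm of [f], the product [m * N] is the Hermitian form of the adjacency
    operator at [f]. Reversing edges shows that it is its own conjugate, and [N] is positive. *)
Lemma cayley_eigenfunction_real f m g :
  cayley_eigenfunction f m -> g \in G -> f g != 0 -> m \is Num.real.
Proof.
move=> fm Gg fg_neq0; pose N := \sum_(g in G) f g * (f g)^*.
have N_gt0: 0 < N.
  rewrite /N (bigD1 g) //= ltr_wpDr ?mul_conjC_gt0 //.
  by rewrite sumr_ge0 // => h _; rewrite mul_conjC_ge0.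
have mN: m * N = \sum_(g in G) \sum_(s in Sigma) f (g * s)%g * (f g)^*.
  rewrite mulr_sumr; apply: eq_bigr => h Gh.
  by rewrite -mulr_suml fm // mulrA.
apply/CrealP/(mulIf (lt0r_neq0 N_gt0)).
have /CrealP NR := gtr0_real N_gt0.
rewrite -{1}NR -rmorphM /= mN [RHS](reindex_edges (fun g h => f h * (f g)^*)).
rewrite rmorph_sum; apply: eq_bigr => h _; rewrite rmorph_sum.
by apply: eq_bigr => s _; rewrite rmorphM /= conjCK mulrC.
Qed.

(** Expand the square: each of the two square terms contributes [#|Sigma|] times the squared norm,
    each of the two cross terms [- m] times it. *)
Lemma cayley_dirichlet f m : m \is Num.real -> cayley_eigenfunction f m ->
  \sum_(g in G) \sum_(s in Sigma) `|f (g * s)%g - f g| ^+ 2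
  = 2 * (#|Sigma|%:R - m) * \sum_(g in G) `|f g| ^+ 2.
Proof.
move=> /CrealP mR fm.
have E1: \sum_(g in G) \sum_(s in Sigma) `|f g| ^+ 2
         = #|Sigma|%:R * \sum_(g in G) `|f g| ^+ 2.
  by rewrite mulr_sumr; apply: eq_bigr => g _; rewrite sumr_const mulr_natl.
have E2: \sum_(g in G) \sum_(s in Sigma) f (g * s)%g * (f g)^*
         = m * \sum_(g in G) `|f g| ^+ 2.
  rewrite mulr_sumr; apply: eq_bigr => g Gg.
  by rewrite -mulr_suml fm // -mulrA normCK.
have E3: \sum_(g in G) \sum_(s in Sigma) f g * (f (g * s)%g)^*
         = m * \sum_(g in G) `|f g| ^+ 2.
  by rewrite -E2 (reindex_edges (fun g h => f h * (f g)^*)).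
have E4: \sum_(g in G) \sum_(s in Sigma) `|f (g * s)%g| ^+ 2
         = #|Sigma|%:R * \sum_(g in G) `|f g| ^+ 2.
  by rewrite -E1 (reindex_edges (fun g _ => `|f g| ^+ 2)).
transitivity (\sum_(g in G) \sum_(s in Sigma)
   (`|f (g * s)%g| ^+ 2 + `|f g| ^+ 2
    - f (g * s)%g * (f g)^* - f g * (f (g * s)%g)^*)).
  apply: eq_bigr => g _; apply: eq_bigr => s _.
  rewrite !normCK rmorphB /=; ring.
under eq_bigr do rewrite !(big_split, sumrN) /=.
rewrite !(big_split, sumrN) /= E1 E2 E3 E4; ring.
Qed.

Lemma cayley_eigenfunction_le f m g :
  cayley_eigenfunction f m -> g \in G -> f g != 0 -> m <= #|Sigma|%:R.
Proof.
move=> fm Gg fg_neq0; have mR := cayley_eigenfunction_real fm Gg fg_neq0.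
have N_gt0: 0 < \sum_(g in G) `|f g| ^+ 2.
  rewrite (bigD1 g) //= ltr_wpDr ?exprn_gt0 ?normr_gt0 //.
  by rewrite sumr_ge0 // => h _; rewrite exprn_ge0.
rewrite -subr_ge0 -(pmulr_rge0 _ (ltr0n _ 2)) -(pmulr_lge0 _ N_gt0).
rewrite -cayley_dirichlet //; do 2!apply: sumr_ge0 => ? _.
by rewrite exprn_ge0.
Qed.

Lemma cayley_eigenfunction_card f : cayley_eigenfunction f #|Sigma|%:R ->
  {in G & <<Sigma>>%g, forall g h, f (g * h)%g = f g}.
Proof.
move=> fk g h Gg Sh.
have /eqP := cayley_dirichlet (realn _ _) fk.
rewrite subrr mulr0 mul0r psumr_eq0 => [/allP f0|x _]; last first.
  by apply: sumr_ge0 => s _; rewrite exprn_ge0.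
(* The right translations preserving [f] form a subgroup, so it suffices that it contains [Sigma];
   this follows from the vanishing of each term of the Dirichlet form. *)
pose H := [set x in G | [forall y in G, f (y * x)%g == f y]].
have gH: group_set H.
  apply/group_setP; split=> [|x y].
    by rewrite inE group1; apply/forall_inP=> x _; rewrite mulg1.
  rewrite !inE => /andP[Gx /forall_inP fx] /andP[Gy /forall_inP fy].
  rewrite groupM //; apply/forall_inP=> z Gz.
  by rewrite mulgA (eqP (fy _ _)) ?fx ?groupM.
suff: h \in Group gH by rewrite inE => /andP[_ /forall_inP/(_ g Gg)/eqP].
apply: (subsetP _ h Sh); rewrite gen_subG; apply/subsetP=> s Ss /=.
rewrite inE (subsetP Sigma_sub) //; apply/forall_inP=> x Gx.
have:= f0 x (mem_index_enum x); rewrite Gx implyTb psumr_eq0; last first.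
  by move=> t _; rewrite exprn_ge0.
move=> /allP/(_ s (mem_index_enum s)); rewrite Ss implyTb.
by rewrite expf_eq0 normr_eq0 subr_eq0.
Qed.

Lemma invariant_cayley_eigenfunction f :
  {in G & Sigma, forall g s, f (g * s)%g = f g} ->
  cayley_eigenfunction f #|Sigma|%:R.
Proof.
move=> fS g Gg; rewrite (eq_bigr (fun=> f g)) => [|s Ss]; last exact: fS.
by rewrite sumr_const mulr_natl.
Qed.

Lemma eigenvalue_cayleyP m : reflect
  (exists f, cayley_eigenfunction f m /\ exists2 g, g \in G & f g != 0)
  (eigenvalue A m).
Proof.
apply: (iffP eigenvalueP) => [[v vA v0]|[f [fm [g Gg fg0]]]].
  have [f def_v] := row_enum_val v; rewrite {v}def_v in vA v0.
  exists f; split; first exact/cayley_eigenfunctionP.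
  have /rV0Pn[i vi0] := v0; exists (enum_val i); first exact: enum_valP.
  by move: vi0; rewrite mxE.
exists (\row_i f (enum_val i)); first exact/cayley_eigenfunctionP.
by apply/rV0Pn; exists (enum_rank_in Gg g); rewrite mxE enum_rankK_in.
Qed.

Lemma max_eigenvalue_cayley : is_max_eigenvalue A #|Sigma|%:R.
Proof.
split; last first.
  move=> m /eigenvalue_cayleyP[f [fm [g Gg]]].
  exact: cayley_eigenfunction_le.
apply/eigenvalue_cayleyP; exists (fun=> 1); split.
  exact: invariant_cayley_eigenfunction.
by exists 1%g; rewrite ?oner_neq0.
Qed.

Lemma rank_eigenspace_cayley :
  (\rank (eigenspace A #|Sigma|%:R) == 1%N) = (<<Sigma>>%g == G).
Proof.
pose E := eigenspace A #|Sigma|%:R; pose one : 'rV[algC]_#|G| := const_mx 1.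
have oneE: one = \row_i (fun=> 1) (enum_val i) by apply/rowP=> i; rewrite !mxE.
have sub1E: (one <= E)%MS.
  apply/eigenspaceP; rewrite oneE; apply/(cayley_eigenfunctionP (fun=> 1)).
  exact: invariant_cayley_eigenfunction.
have one0: one != 0.
  apply/rV0Pn; exists (enum_rank_in (group1 G) 1%g).
  by rewrite mxE oner_neq0.
have rank_one: \rank one = 1%N by rewrite rank_rV one0.
apply/eqP/eqP=> [rankE | genG].
  have Eone: (E <= one)%MS.
    by rewrite -(mxrank_leqif_sup sub1E) rank_one rankE.
  (* The indicator function of <<Sigma>> is invariant, so it must be constant. *)
  pose f g : algC := (g \in <<Sigma>>%g)%:R.
  have fk: cayley_eigenfunction f #|Sigma|%:R.
    apply: invariant_cayley_eigenfunction => g s _ Ss.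
    by rewrite /f groupMr // mem_gen.
  have /eigenspaceP := (cayley_eigenfunctionP f _).1 fk.
  move/submx_trans/(_ Eone)/sub_rVP=> [c /rowP fc].
  apply/eqP; rewrite eqEsubset gen_subG Sigma_sub; apply/subsetP=> g Gg.
  have fE x: x \in G -> f x = c.
    by move=> Gx; have := fc (enum_rank_in Gx x);
      rewrite !mxE enum_rankK_in // mulr1.
  have: f g = f 1%g by rewrite !fE.
  rewrite /f group1; case: (g \in _) => // /eqP.
  by rewrite eq_sym oner_eq0.
apply/eqP; rewrite eqn_leq -{2}rank_one (mxrankS sub1E) andbT -rank_one.
apply: mxrankS; apply/rV_subP=> v /eigenspaceP.
have [f ->] := row_enum_val v.
move=> /cayley_eigenfunctionP/cayley_eigenfunction_card fk.
(* Invariance under [<<Sigma>>], here all of [G], gives [f g = f (1 * g) = f 1], so [f] is constant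
   on [G]. *)
apply/sub_rVP; exists (f 1%g).
apply/rowP=> i; rewrite !mxE mulr1 -[in LHS](mul1g (enum_val i)).
by apply: fk; rewrite ?genG ?enum_valP.
Qed.

Lemma has_spectral_gap_cayley :
  has_spectral_gap G (cayley Sigma) <-> <<Sigma>>%g = G :> {set gT}.
Proof.
split=> [[l [Al lmax] ml]|/eqP]; last first.
  rewrite -rank_eigenspace_cayley => /eqP rk.
  exists #|Sigma|%:R; first exact: max_eigenvalue_cayley.
  by rewrite mup_char_poly_normal // adjacency_cayley_normal.
apply/eqP; rewrite -rank_eigenspace_cayley.
have [Ak kmax] := max_eigenvalue_cayley.
have lk: l = #|Sigma|%:R by apply/eqP; rewrite eq_le kmax ?lmax.
by rewrite -lk -mup_char_poly_normal ?ml // adjacency_cayley_normal.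
Qed.

(** * Transfer from representations to the Cayley graph *)

Section Representation.

Variables (n : nat) (rG : mx_representation algC G n).

(** The inverse suits row vectors: [rG (g * s)^-1] is [rG s^-1 *m rG g^-1], so the sum over [s] acts
    directly on [v]. *)
Lemma repr_sum_eigenfunction (v : 'rV_n) m j :
  v *m repr_sum rG Sigma = m *: v ->
  cayley_eigenfunction (fun g => (v *m rG g^-1%g) 0 j) m.
Proof.
move=> vm g Gg.
transitivity ((v *m repr_sum rG Sigma *m rG g^-1%g) 0 j); last first.
  by rewrite vm -scalemxAl mxE.
rewrite /repr_sum mulmx_sumr mulmx_suml summxE (reindex_inj invg_inj) /=.
apply: eq_big => [s|s Ss]; first exact: memV_Sigma.
rewrite invMg invgK -mulmxA repr_mxM ?groupV //.
by rewrite (subsetP Sigma_sub) // -memV_Sigma.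
Qed.

Lemma eigenvalue_repr_sum m :
  eigenvalue (repr_sum rG Sigma) m -> eigenvalue A m.
Proof.
case/eigenvalueP=> v vm /rV0Pn[j vj0]; apply/eigenvalue_cayleyP.
exists (fun g => (v *m rG g^-1%g) 0 j); split.
  exact: repr_sum_eigenfunction.
by exists 1%g; rewrite // invg1 repr_mx1 mulmx1.
Qed.

Lemma eigenvalue_repr_sum_card :
  eigenvalue (repr_sum rG Sigma) #|Sigma|%:R = (rfix_mx rG <<Sigma>>%g != 0).
Proof.
have sSG: <<Sigma>>%g \subset G by rewrite gen_subG.
apply/eigenvalueP/rowV0Pn=> [[v vk v0]|[v /rfix_mxP vS v0]]; exists v => //.
  (* The [j]-th matrix coefficient of [v] is invariant under [<<Sigma>>]; comparing its values at
     [g^-1] and at [1] gives the [j]-th entry of [v *m rG g = v]. *)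
  apply/rfix_mxP=> g Sg; apply/rowP=> j.
  have := cayley_eigenfunction_card (repr_sum_eigenfunction j vk) (group1 G).
  by move/(_ g^-1%g); rewrite groupV mul1g invgK invg1 repr_mx1 mulmx1; apply.
rewrite /repr_sum mulmx_sumr (eq_bigr (fun=> v)) => [|s Ss].
  by rewrite sumr_const scaler_nat.
by rewrite vS ?mem_gen.
Qed.

(** The spectrum of the sum lies in that of the Cayley graph, hence is real and bounded by
    [#|Sigma|]. *)
Lemma max_eigenvalue_repr_sum : (0 < n)%N ->
  exists2 l, is_max_eigenvalue (repr_sum rG Sigma) l & l <= #|Sigma|%:R.
Proof.
move=> n_gt0.
have [||l [Al lmax]] := @max_eigenvalue_exists _ (repr_sum rG Sigma).
- by [].
- move=> m /eigenvalue_repr_sum/eigenvalue_cayleyP[f [fm [g Gg]]].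
  exact: cayley_eigenfunction_real fm Gg.
by exists l => //; apply: max_eigenvalue_cayley.2; apply: eigenvalue_repr_sum.
Qed.

End Representation.

End CayleyEigenfunctions.

(** * Invariant vectors of irreducible representations *)

Section FixedVectors.

Variables (gT : finGroupType) (G : {group gT}) (i : Iirr G).

(** A nonzero fixed space is a submodule, hence everything by irreducibility. Then ['chi_i] is
    constant on [G] and not orthogonal to the trivial character, which forces [i = 0]. *)
Lemma rfix_irr : i != 0 -> rfix_mx 'Chi_i G = 0.
Proof.
apply: contraNeq => fix0.
have /mx_irrP[n_gt0 irr] := socle_irr (socle_of_Iirr i).
have := irr _ (rfix_mx_module _) fix0; rewrite -sub1mx => /rfix_mxP chi1.
have: '['chi_i, 'chi_0] != 0.
  rewrite irr0 cfdotE mulf_neq0 ?invr_eq0 ?neq0CG //.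
  rewrite (eq_bigr (fun=> 'chi_i 1%g)) => [|g Gg].
    by rewrite sumr_const -mulr_natl mulf_neq0 ?neq0CG ?irr1_neq0.
  rewrite cfun1E Gg conjC1 mulr1 -irrRepr !cfunE Gg group1.
  by rewrite repr_mx1 -(chi1 g Gg) mul1mx.
by rewrite cfdot_irr pnatr_eq0 eqb0 negbK => ->.
Qed.

Lemma rfix_mx_neq0 (K : {group gT}) : K \subset G ->
  0 < '['Res[K] 'chi_i, 1]_K -> rfix_mx 'Chi_i K != 0.
Proof.
move=> sKG; apply: contraTneq => fix0.
(* Divided by #|K|, [e] is the projector onto the K-invariants, whose trace is
   the multiplicity '['Res[K] 'chi_i, 1]. *)
pose e := \sum_(k in K) 'Chi_i k.
have e0: e = 0.
  (* Right multiplication by [x] permutes the summands of [e], so the rows of [e] are [K]-invariant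
     vectors. *)
  apply/eqP; rewrite -submx0 -fix0; apply/rfix_mxP=> x Kx.
  rewrite mulmx_suml [RHS](reindex_inj (mulIg x)) /=.
  apply: eq_big => k; first by rewrite groupMr.
  by move=> Kk; rewrite repr_mxM // (subsetP sKG).
rewrite cfdotE (_ : \sum_(x in K) _ = \tr e); last first.
  rewrite raddf_sum; apply: eq_bigr => k Kk; have Gk := subsetP sKG k Kk.
  by rewrite cfun1E Kk conjC1 mulr1 cfResE // -irrRepr cfunE Gk.
by rewrite e0 mxtrace0 mulr0 ltxx.
Qed.

End FixedVectors.

Theorem proposition1p4 (gT : finGroupType) (G : {group gT})
    (X : {set Iirr G}) (X_nontrivial : 0 \notin X)
    (X_marks : forall K : {group gT}, K \proper G -> marks X K)
    (Sigma : {set gT}) (Sigma_sub : Sigma \subset G)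
    (Sigma_sym : symmetric_set Sigma) :
  [<-> <<Sigma>>%g = G :> {set gT};
       has_spectral_gap G (cayley Sigma);
       forall i : Iirr G, i \in X ->
         exists2 l, is_max_eigenvalue (repr_sum 'Chi_i Sigma) l
                  & l < #|Sigma|%:R ].
Proof.
have gapP := has_spectral_gap_cayley Sigma_sub Sigma_sym.
tfae; first by move/gapP.
- move=> /gapP genG i Xi.
  have [|l lmax le_lk] := max_eigenvalue_repr_sum Sigma_sub Sigma_sym 'Chi_i.
    by rewrite irr_degree_gt0.
  exists l => //; rewrite lt_neqAle le_lk andbT.
  (* If the maximum were [#|Sigma|], then ['Chi_i] would have nonzero [G]-invariants, so [i = 0]
     would lie in [X]. *)
  apply: contraNneq X_nontrivial => lk; have [Al _] := lmax.
  have:= eigenvalue_repr_sum_card Sigma_sub Sigma_sym 'Chi_i.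
  rewrite -lk Al genG => /esym; have [<- // | /rfix_irr->] := eqVneq i 0.
  by rewrite eqxx.
move=> lt_k; apply/eqP; rewrite eqEproper gen_subG Sigma_sub /=.
(* If [<<Sigma>>] is proper, the marking character has nonzero [<<Sigma>>]-invariants, which makes
   [#|Sigma|] an eigenvalue above the assumed maximum. *)
apply/negP=> /X_marks[i Xi /rfix_mx_neq0 fixS].
have [l [_ lmax] lt_lk] := lt_k i Xi.
have: eigenvalue (repr_sum 'Chi_i Sigma) #|Sigma|%:R.
  by rewrite (eigenvalue_repr_sum_card Sigma_sub) // fixS // gen_subG.
by move/lmax/le_lt_trans/(_ lt_lk); rewrite ltxx.
Qed.
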